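(* Let $K_2$ be the set of points of $[0,1]$ whose base $10^{9000}$ expansions contain only digits in $\{0,\dots,10^{7000}-1\}$. Then the arithmetic product set \[ K_2\cdot K_2=\{xy: x,y\in K_2\} \] has non-empty interior. *)

(* Defs.v *)
From mathcomp Require Import all_boot all_order all_algebra.
From mathcomp Require Import all_classical all_reals all_analysis.
Set Implicit Arguments.
Unset Strict Implicit.
Unset Printing Implicit Defensive.
Import Order.TTheory GRing.Theory Num.Theory.
Import numFieldNormedType.Exports.
Local Open Scope classical_set_scope.
Local Open Scope ring_scope.

(* The fractional expansion x = 0.d_0 d_1 d_2 ... in base b: the digit d_i
   carries the weight b^-(i+1). *)
Definition is_base_expansion (R : realType) (b : nat) (d : nat -> nat) (x : R)
    : Prop :=
  (forall i, (d i < b)%N) /\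
  series (fun i : nat => (d i)%:R / (b%:R : R) ^+ i.+1) @ \oo --> x.

(* A point with two expansions belongs to this set as soon as one of them uses
   only digits in D. *)
Definition restricted_digits (R : realType) (b : nat) (D : set nat) : set R :=
  [set x | 0 <= x <= 1 /\
    exists2 d : nat -> nat, is_base_expansion b d x & forall i, D (d i)].

Definition K2 (R : realType) : set R :=
  restricted_digits (10 ^ 9000)%N [set k : nat | (k < 10 ^ 7000)%N].
Arguments K2 R : clear implicits.

Definition arith_prod (R : realType) (A B : set R) : set R :=
  [set x * y | x in A & y in B].

(* Main.v *)
(* Write the base as N = r^2 (so r = 10^4500) and let the first digits of x and
   y be 27(r + 1) and 27r. To first order, appending the digits t to x and s to
   y changes xy by 27(s(r + 1) + tr) times a power of 1/N, and the integers
   s(r + 1) + tr with s < r and t <= 3r fill the whole range from r^2 - 2 to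
   3r^2. Since these steps are narrower than the range of admissible errors, a
   greedy choice of digits approaches every target z close to the product of
   the two initial truncations; digits at most 3r keep the second-order terms
   below one step. *)
Require Import Defs.
From mathcomp Require Import all_boot all_order all_algebra.
From mathcomp Require Import all_classical all_reals all_analysis.
From mathcomp Require Import zify ring lra.
Set Implicit Arguments.
Unset Strict Implicit.
Unset Printing Implicit Defensive.
Import Order.TTheory GRing.Theory Num.Theory.
Import numFieldNormedType.Exports.
Local Open Scope classical_set_scope.
Local Open Scope ring_scope.

(* Here x = (27(r + 1) + e) / r^2 and y = (27r + f) / r^2 are truncated after
   n + 1 digits, v = r^(-2n), and Z = r^4 z for the target product z. The
   factor 27 = 6 + 18 + 3 absorbs the three error terms e s, f t, s t v / r^2 of
   a refinement step. *)
Definition refinable (R : realType) (r : nat) (Z v e f : R) : Prop :=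
  [/\ 0 <= e <= 6 / r%:R * (1 - v), 0 <= f <= 6 / r%:R * (1 - v) &
      27 * v <= Z - (27 * (r%:R + 1) + e) * (27 * r%:R + f) <= 81 * v].

(** Euclidean division [M = q * r + s] rewrites as [s * (r + 1) + (q - s) * r]. The lower bound on
    [M] gives [M >= (r - 1) * r], so [q >= r - 1 >= s] and the difference is a true subtraction. *)
Lemma quotient_digits (r M : nat) : (1 < r)%N ->
  (r ^ 2 <= M + 2)%N -> (M <= 3 * r ^ 2)%N ->
  exists s t : nat,
    [/\ (s < r)%N, (t <= 3 * r)%N & (M = s * (r + 1) + t * r)%N].
Proof.
move=> r1 leM Mle.
have ltr : (M %% r < r)%N by rewrite ltn_mod; lia.
have eqM := divn_eq M r.
have le_q : (M %% r <= M %/ r)%N.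
  suff : (r.-1 <= M %/ r)%N by lia.
  by rewrite leq_divRL; nia.
exists (M %% r)%N, (M %/ r - M %% r)%N; split => //; last by nia.
have : (M %/ r <= 3 * r)%N by rewrite -ltnS ltn_divLR; nia.
lia.
Qed.

Lemma refinable_step (R : realType) (r : nat) (Z v e f : R) :
  (1 < r)%N -> 0 < v <= 1 -> refinable r Z v e f ->
  exists s t : nat, [/\ (s <= 3 * r)%N, (t <= 3 * r)%N &
    refinable r Z (v / r%:R ^+ 2)
      (e + t%:R * (v / r%:R ^+ 2)) (f + s%:R * (v / r%:R ^+ 2))].
Proof.
move=> r1 /andP[v0 v1] [/andP[e0 e1] /andP[f0 f1]].
set w := Z - _ => /andP[w1 w3].
have r2 : 2 <= r%:R :> R by rewrite ler_nat.
(* [y] is the remainder [w] measured in units of [27 * v / r ^ 2], the first-order effect of raising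
   [s (r + 1) + t r] by one. *)
pose y := r%:R ^+ 2 * w / (27 * v).
have v27 : 0 < 27 * v by lra.
have y1 : r%:R ^+ 2 <= y by rewrite ler_pdivlMr // ler_pM2l //; nra.
have y3 : y <= 3 * r%:R ^+ 2 by rewrite ler_pdivrMr //; nra.
have y0 : 0 <= y by nra.
have /andP[ky yk] := truncn_itv y0.
set k := Num.truncn y in ky yk.
have rk : (r ^ 2 <= k)%N.
  by rewrite -ltnS -(ltr_nat R) natrX (le_lt_trans y1).
have k3 : (k <= 3 * r ^ 2)%N.
  by rewrite -(ler_nat R) natrM natrX (le_trans ky).
have k2 : (k - 2 + 2 = k)%N.
  apply: subnK; apply: leq_trans rk.
  by rewrite (@leq_trans (2 ^ 2)) // leq_exp2r.
(* Stopping two units below [k] leaves between two and three units, that is 54 to 81 times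
   [v / r ^ 2]. The error terms then remove at most 27 times [v / r ^ 2], which keeps the remainder
   in the window. *)
have [||s [t [sr tr kE]]] := @quotient_digits r (k - 2) r1.
- by rewrite k2.
- by rewrite (leq_trans (leq_subr _ _)).
exists s, t; split => //; first by rewrite (leq_trans (ltnW sr)) // leq_pmull.
have kR : k%:R = s%:R * (r%:R + 1) + t%:R * r%:R + 2 :> R.
  by rewrite -[in LHS]k2 kE !natrD !natrM natrD.
have {}sr : s%:R <= r%:R :> R by rewrite ler_nat ltnW.
have {}tr : t%:R <= 3 * r%:R :> R by rewrite -natrM ler_nat.
have s0 : 0 <= s%:R :> R by [].
have t0 : 0 <= t%:R :> R by [].
have {}yk : y < k%:R + 1 by rewrite natr1.
clear rk k3 k2 kE r1; rewrite /refinable.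
have wE : w = 27 * v * y / r%:R ^+ 2 by rewrite /y; field; lra.
have ZE : Z = w + (27 * (r%:R + 1) + e) * (27 * r%:R + f) by rewrite /w; ring.
clearbody w y k.
move: (r%:R) (s%:R) (t%:R) (k%:R) r2 y1 y3 ky yk kR sr tr s0 t0 e1 f1 wE ZE
  w1 w3 => ρ σ τ κ r2 y1 y3 ky yk kR sr tr s0 t0 e1 f1 wE ZE w1 w3.
have ρ0 : 0 < ρ by lra.
set q := v / ρ ^+ 2.
have q0 : 0 < q by rewrite divr_gt0 ?exprn_gt0.
have vE : v = q * ρ ^+ 2 by rewrite /q; field; lra.
rewrite -/q; clearbody q.
(* Passing from [v] to [q] raises the bound by [q * (6 / ρ * (ρ ^+ 2 - 1))], which covers a new
   digit [d <= 3 * ρ] because [ρ ^+ 2 <= 2 * (ρ ^+ 2 - 1)] for [ρ >= 2]. *)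
have bound (x d : R) : 0 <= d <= 3 * ρ -> 0 <= x <= 6 / ρ * (1 - v) ->
    0 <= x + d * q <= 6 / ρ * (1 - q).
  move=> /andP[d0 d3] /andP[x0 x1]; apply/andP; split; first by nra.
  have : 3 * ρ <= 6 / ρ * (ρ ^+ 2 - 1).
    by rewrite mulrAC ler_pdivlMr //; nra.
  have : 6 / ρ * (1 - q) = 6 / ρ * (1 - v) + q * (6 / ρ * (ρ ^+ 2 - 1)).
    by rewrite vE; ring.
  by nra.
have small (x : R) : 0 <= x <= 6 / ρ * (1 - v) -> x * ρ <= 6.
  move=> /andP[_ x1]; have := ler_wpM2r (ltW ρ0) x1.
  have -> : 6 / ρ * (1 - v) * ρ = 6 * (1 - v) by field; lra.
  by lra.
split; [by apply: bound; lra|by apply: bound; lra|].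
have eρ := small e ltac:(lra).
have fρ := small f ltac:(lra).
have {}wE : w = 27 * q * y by rewrite wE vE; field; lra.
pose E := e * σ + f * τ + σ * τ * q.
have -> : Z - (27 * (ρ + 1) + (e + τ * q)) * (27 * ρ + (f + σ * q)) =
    q * (27 * (y - κ + 2) - E).
  by rewrite ZE wE /E kR; ring.
have q0' := ltW q0.
have E0 : 0 <= E by rewrite /E !addr_ge0 ?mulr_ge0.
have E1 : e * σ <= 6 by rewrite (le_trans _ eρ) // ler_wpM2l.
have E2 : f * τ <= 18 by have := ler_wpM2l f0 tr; lra.
have E3 : σ * τ * q <= 3.
  have : σ * τ <= ρ * (3 * ρ) by rewrite ler_pM.
  by move=> /(ler_wpM2r q0'); move: v1; rewrite vE; lra.
have {E1 E2 E3} E27 : E <= 27 by rewrite /E; lra.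
clearbody E.
by rewrite -!(mulrC q) !ler_pM2l //; apply/andP; split; lra.
Qed.

Lemma refinable_digits (R : realType) (r : nat) (Z : R) : (1 < r)%N ->
  refinable r Z 1 0 0 ->
  exists s t : nat -> nat,
    [/\ forall i, (s i <= 3 * r)%N, forall i, (t i <= 3 * r)%N &
     forall n, refinable r Z ((r%:R ^+ 2) ^- n)
       (\sum_(0 <= i < n) (t i)%:R / (r%:R ^+ 2) ^+ i.+1)
       (\sum_(0 <= i < n) (s i)%:R / (r%:R ^+ 2) ^+ i.+1)].
Proof.
move=> r1 Z0.
pose V n : R := (r%:R ^+ 2) ^- n.
have r0 : 0 < r%:R ^+ 2 :> R by rewrite exprn_gt0 // ltr0n; lia.
have Vlt n : 0 < V n <= 1.
  have Vn1 : 1 <= (r%:R ^+ 2) ^+ n :> R.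
    by rewrite !exprn_ege1 // ler1n ltnW.
  by rewrite /V invr_gt0 exprn_gt0 //= invf_le1 // exprn_gt0.
have VS n : V n.+1 = V n / r%:R ^+ 2 by rewrite /V exprSr invfM mulrC.
(* Choice needs digits at every state [p], so refinability is a premise of the last clause only.
   Other states get the digits 0, and the digit bounds hold without induction. *)
have step (p : nat * (R * R)) : exists d : nat * nat,
    [/\ (d.1 <= 3 * r)%N, (d.2 <= 3 * r)%N &
     refinable r Z (V p.1) p.2.1 p.2.2 ->
     refinable r Z (V p.1.+1)
       (p.2.1 + d.2%:R * V p.1.+1) (p.2.2 + d.1%:R * V p.1.+1)].
  case: (pselect (refinable r Z (V p.1) p.2.1 p.2.2)) => [Zp|nZp].
    have [s [t [s3 t3 st]]] := refinable_step r1 (Vlt p.1) Zp.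
    by exists (s, t); split => // _; rewrite VS.
  by exists (0, 0)%N.
have [d dP] := choice step.
pose fix p (n : nat) : R * R := if n is m.+1 then
  ((p m).1 + (d (m, p m)).2%:R * V m.+1, (p m).2 + (d (m, p m)).1%:R * V m.+1)
  else (0, 0).
exists (fun i => (d (i, p i)).1), (fun i => (d (i, p i)).2).
split=> [i|i|n]; [by have [] := dP (i, p i)|by have [] := dP (i, p i)|].
have -> : \sum_(0 <= i < n) (d (i, p i)).2%:R / (r%:R ^+ 2) ^+ i.+1 = (p n).1.
  by elim: n => [|n IHn]; [rewrite big_geq|rewrite big_nat_recr //= IHn].
have -> : \sum_(0 <= i < n) (d (i, p i)).1%:R / (r%:R ^+ 2) ^+ i.+1 = (p n).2.
  by elim: n => [|n IHn]; [rewrite big_geq|rewrite big_nat_recr //= IHn].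
elim: n => [|n IHn]; first by rewrite expr0 invr1.
by have [_ _] := dP (n, p n); apply.
Qed.

Lemma base_expansion_exists (R : realType) (b : nat) (d : nat -> nat) :
  (1 < b)%N -> (forall i, (d i < b)%N) ->
  exists2 x : R, 0 <= x <= 1 & is_base_expansion b d x.
Proof.
move=> b1 db.
set u := series (fun i => (d i)%:R / (b%:R : R) ^+ i.+1).
have b0 : 0 < b%:R :> R by rewrite ltr0n; lia.
have u0 i : 0 <= (d i)%:R / b%:R ^+ i.+1 :> R.
  by rewrite divr_ge0 ?exprn_ge0 ?(ltW b0).
have u_nd : nondecreasing_seq u by apply: nondecreasing_series => i _ _.
(* The slack [b ^- n] makes the bound inductive: the largest digit [b - 1] uses up exactly its
   decrease. *)
have u1 n : u n <= 1 - b%:R ^- n.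
  elim: n => [|n IHn].
    by rewrite /u /series /= big_geq // expr0 invr1 subrr lexx.
  rewrite /u seriesSr -/u.
  have : (d n)%:R / b%:R ^+ n.+1 <= (b%:R - 1) / b%:R ^+ n.+1 :> R.
    by rewrite ler_pM2r ?invr_gt0 ?exprn_gt0 // lerBrDr natr1 ler_nat.
  have -> : (b%:R - 1) / b%:R ^+ n.+1 = b%:R ^- n - b%:R ^- n.+1 :> R.
    by rewrite exprS; field; rewrite expf_neq0 ?gt_eqF.
  by move: IHn; lra.
have {}u1 n : u n <= 1.
  by rewrite (le_trans (u1 n)) // gerBl invr_ge0 exprn_ge0 // ltW.
have u_cvg : cvgn u.
  by apply: nondecreasing_is_cvgn => //; exists 1 => _ [n _ <-].
exists (limn u) => //; apply/andP; split.
  by apply: limr_ge => //; near=> n; apply: sumr_ge0 => i _.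
by apply: limr_le => //; near=> n.
Unshelve. all: by end_near. Qed.

(** The digit range only has to exceed a constant multiple of the square root of the base, enough
    for the leading digits and for later digits up to [3 * r]. *)
Lemma interior_restricted_digits_prod (R : realType) (r m : nat) :
  (27 * (r + 1) < m)%N -> (m <= r ^ 2)%N ->
  let K := @restricted_digits R (r ^ 2) [set k | (k < m)%N] in
  interior (arith_prod K K) !=set0.
Proof.
move=> rm mr K.
have r1 : (1 < r)%N by nia.
have N1 : (1 < r ^ 2)%N by nia.
pose N : R := r%:R ^+ 2.
have NE : (r ^ 2)%:R = N by rewrite natrX.
have N0 : 0 < N by rewrite -NE ltr0n; lia.
have NN0 : 0 < N ^+ 2 by rewrite exprn_gt0.
pose c : R := 27 * (r%:R + 1) * (27 * r%:R).
(* This is the midpoint of the targets [z] for which the initial state, with [v = 1] and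
   [e = f = 0], is refinable. *)
exists ((c + 54) / N ^+ 2).
have /filterS : forall z : R, z \in `](c + 27) / N ^+ 2, (c + 81) / N ^+ 2[ ->
    arith_prod K K z; last first.
  apply; apply: near_in_itvoo.
  rewrite in_itv /=; apply/andP.
  by split; rewrite ltr_pM2r ?invr_gt0 // ltrD2l ltr_nat.
move=> z; rewrite in_itv /= ltr_pdivrMr // ltr_pdivlMr //.
move=> /andP[z1 z3].
have [||s [t [s3 t3 st]]] := @refinable_digits R r (z * N ^+ 2) => //.
  by split; rewrite ?subrr ?mulr0 ?lexx // !addr0 -/c !mulr1; lra.
pose dx i := (if i is j.+1 then t j else 27 * (r + 1))%N.
pose dy i := (if i is j.+1 then s j else 27 * r)%N.
have dxm i : (dx i < m)%N by case: i => //= i; have := t3 i; lia.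
have dym i : (dy i < m)%N by case: i => /= [|i]; [|have := s3 i]; lia.
have [||x x01 dx_x] := @base_expansion_exists R (r ^ 2) dx => //.
  by move=> i; apply: leq_trans mr.
have [||y y01 dy_y] := @base_expansion_exists R (r ^ 2) dy => //.
  by move=> i; apply: leq_trans mr.
exists x; first by split => //; exists dx.
exists y; first by split => //; exists dy.
case: dx_x dy_y => _ + [_]; rewrite NE.
set X := series _ => X_x; set Y := series _ => Y_y.
have shift (d : nat -> nat) (a n : nat) :
    series (fun i => (if i is j.+1 then d j else a)%:R / N ^+ i.+1) n.+1 =
    (a%:R + \sum_(0 <= i < n) (d i)%:R / N ^+ i.+1) / N.
  rewrite /series /= big_nat_recl // expr1 mulrDl mulr_suml; congr (_ + _).
  by apply: eq_bigr => i _; rewrite [in LHS]exprSr invfM mulrA.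
have XY_xy : X n.+1 * Y n.+1 @[n --> \oo] --> x * y.
  by apply: cvgM; [rewrite (cvg_shiftS X)|rewrite (cvg_shiftS Y)].
(* Refinability at stage [n] concerns [n + 1] digits, the leading one included, and puts the product
   below [z] by at most [81 / N ^+ 2 * N ^- n]. *)
have XY_z : X n.+1 * Y n.+1 @[n --> \oo] --> z.
  have V0 : N^-1 ^+ n @[n --> \oo] --> (0 : R).
    apply: cvg_expr; rewrite ger0_norm ?invr_ge0 ?ltW // invf_lt1 //.
    by rewrite -NE ltr1n.
  have low : z - 81 / N ^+ 2 * N^-1 ^+ n @[n --> \oo] --> z.
    rewrite -[X in _ --> X]subr0 -[X in _ - X](mulr0 (81 / N ^+ 2)).
    by apply: cvgB; [exact: cvg_cst|apply: cvgMr].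
  apply: (squeeze_cvgr _ low (@cvg_cst _ z _ _ _)); near=> n.
  have [_ _] := st n; rewrite /X /Y !shift -/N.
  set e := \sum_(0 <= i < n) _; set f := \sum_(0 <= i < n) _.
  rewrite exprVn natrM natrD natrM; set V := N ^- n => /andP[lo hi].
  have V0' : 0 < V by rewrite invr_gt0 exprn_gt0.
  rewrite mulf_div -expr2 ler_pdivlMr // ler_pdivrMr //.
  have -> : (z - 81 / N ^+ 2 * V) * N ^+ 2 = z * N ^+ 2 - 81 * V.
    by field; rewrite gt_eqF.
  by apply/andP; split; lra.
exact: cvg_unique XY_xy XY_z.
Unshelve. all: by end_near. Qed.

Theorem theoremC (R : realType) :
  interior (arith_prod (K2 R) (K2 R)) !=set0.
Proof.
have pow9000 : (10 ^ 9000 = (10 ^ 4500) ^ 2)%N by rewrite -expnM.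
rewrite /K2 pow9000; apply: interior_restricted_digits_prod; last first.
  by rewrite -expnM leq_exp2l.
(* With [r = 10 ^ 4500], the leading digit [27 * (r + 1)] is below [100 * r]. *)
apply: (@leq_trans (10 ^ (4500 + 2))%N); last by rewrite leq_exp2l.
have : (0 < 10 ^ 4500)%N by rewrite expn_gt0.
by rewrite expnD; move: (10 ^ 4500)%N => r; lia.
Qed.
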